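(* Let $n$ be a positive integer and let $K$ be a field. Then $K_0(MC_n(K))\cong\mathbb{Z}[\tfrac{1}{n}]$ as abelian groups, and $MC_n(K)$ has the invariant basis number property.
   Context: For a ring $R$ (associative with $1$), $K_0(R)$ is the Grothendieck group of the commutative monoid of isomorphism classes of finitely generated projective left $R$-modules under direct sum. $R$ has invariant basis number if for all natural numbers $p,q$, $R^p\cong R^q$ as left $R$-modules implies $p=q$. $M_m(R)$ is the ring of $m\times m$ matrices over $R$. Identify $M_n(M_{n^k}(R))$ with $M_{n^{k+1}}(R)$ via block matrices. The $n$-matricial closure $MC_n(R)$ is the direct limit of the rings $M_{n^k}(R)$, $k\in\mathbb{N}=\{0,1,2,\dots\}$ (with $M_{n^0}(R)=R$), along the injective ring morphisms $M_{n^k}(R)\to M_{n^{k+1}}(R)$ sending $A$ to the block diagonal matrix with $n$ diagonal blocks equal to $A$. $\mathbb{Z}[\tfrac1n]$ is the additive group of the subring of $\mathbb{Q}$ generated by $\tfrac1n$. *)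

(* Defs.v *)
From HB Require Import structures.
From mathcomp Require Import all_boot all_order all_algebra.
From mathcomp Require Import boolp.

Set Implicit Arguments.
Unset Strict Implicit.
Unset Printing Implicit Defensive.

Import GRing.Theory.

Local Open Scope ring_scope.
Local Open Scope quotient_scope.

Section Modules.
Variable R : pzRingType.
Implicit Types P Q S : lmodType R.

Definition mod_iso P Q : Prop := exists f : {linear P -> Q}, bijective f.

Definition fin_gen P : Prop :=
  exists (n : nat) (s : 'I_n -> P), forall x : P,
    exists c : 'I_n -> R, x = \sum_(i < n) c i *: s i.

Definition projective P : Prop :=
  forall (M N : lmodType R) (g : {linear M -> N}) (h : {linear P -> N}),
    (forall y, exists x, g x = y) ->
    exists k : {linear P -> M}, forall x, g (k x) = h x.

Record fgproj := FGProj {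
  fgproj_mod :> lmodType R;
  fgproj_fin_gen : fin_gen fgproj_mod;
  fgproj_projective : projective fgproj_mod }.

Lemma linear_ex (U V : lmodType R) (f : U -> V) :
  linear f -> exists g : {linear U -> V}, g =1 f.
Proof.
move=> lf.
by exists (HB.pack_for {linear U -> V} f (GRing.isLinear.Build R U V _ f lf)).
Qed.

Lemma mod_iso_refl P : mod_iso P P.
Proof. by exists idfun; exists id. Qed.

Lemma mod_iso_sym P Q : mod_iso P Q -> mod_iso Q P.
Proof.
case=> f [g fK gK]; have lg : linear g.
  by move=> a u v; apply: (can_inj fK); rewrite linearP !gK.
have [h hE] := linear_ex lg; exists h; exists f => x; by rewrite hE ?gK ?fK.
Qed.

Lemma mod_iso_trans P Q S : mod_iso P Q -> mod_iso Q S -> mod_iso P S.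
Proof.
case=> f bf [g bg].
have [h hE] : exists h : {linear P -> S}, h =1 g \o f.
  by apply: linear_ex => a u v /=; rewrite !linearP.
by exists h; apply: (@eq_bij _ _ (g \o f)) => //; exact: bij_comp.
Qed.

Lemma mod_iso_prod P P' Q Q' :
  mod_iso P P' -> mod_iso Q Q' -> mod_iso (P * Q)%type (P' * Q')%type.
Proof.
case=> f [f' fK f'K] [g [g' gK g'K]].
have [h hE] : exists h : {linear (P * Q)%type -> (P' * Q')%type},
    h =1 fun x => (f x.1, g x.2).
  by apply: linear_ex => a u v /=; rewrite !linearP.
exists h; exists (fun y => (f' y.1, g' y.2)).
  by case=> x y; rewrite hE /= fK gK.
by case=> x y; rewrite hE /= f'K g'K.
Qed.

Lemma mod_iso_prodC P Q : mod_iso (P * Q)%type (Q * P)%type.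
Proof.
have [h hE] : exists h : {linear (P * Q)%type -> (Q * P)%type},
    h =1 fun x => (x.2, x.1) by apply: linear_ex.
by exists h; exists (fun x => (x.2, x.1)) => -[x y]; rewrite hE.
Qed.

Lemma mod_iso_prodA P Q S :
  mod_iso (P * (Q * S))%type (P * Q * S)%type.
Proof.
have [h hE] : exists h : {linear (P * (Q * S))%type -> (P * Q * S)%type},
    h =1 fun x => (x.1, x.2.1, x.2.2) by apply: linear_ex.
exists h; exists (fun x => (x.1.1, (x.1.2, x.2))).
  by case=> x [y z]; rewrite hE.
by case=> [[x y] z]; rewrite hE.
Qed.

Lemma sum_pair P Q n (F : 'I_n -> P) (G : 'I_n -> Q) :
  \sum_(i < n) (F i, G i) = (\sum_(i < n) F i, \sum_(i < n) G i).
Proof. by elim/big_rec3: _ => // i x y z _ ->. Qed.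

Lemma fin_gen_prod P Q : fin_gen P -> fin_gen Q -> fin_gen (P * Q)%type.
Proof.
case=> m [s sP] [n [t tP]].
exists (m + n)%N, (fun i => match split i with
  inl j => (s j, 0) | inr j => (0, t j) end) => -[x y].
have [c ->] := sP x; have [d ->] := tP y.
exists (fun i => match split i with inl j => c j | inr j => d j end).
have sl i : split (lshift n i) = inl i := unsplitK (inl i).
have sr i : split (rshift m i) = inr i := unsplitK (inr i).
rewrite big_split_ord /=.
rewrite (eq_bigr (fun i => (c i *: s i, 0))); last first.
  by move=> i _; rewrite sl; congr pair; exact: scaler0.
rewrite [X in _ + X](eq_bigr (fun i => (0, d i *: t i))); last first.
  by move=> i _; rewrite sr; congr pair; exact: scaler0.
by rewrite !sum_pair !big1_eq; congr pair; rewrite ?addr0 ?add0r.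
Qed.

Lemma projective_prod P Q :
  projective P -> projective Q -> projective (P * Q)%type.
Proof.
move=> pP pQ M N g h gS.
have [h1 h1E] : exists h1 : {linear P -> N}, h1 =1 fun x => h (x, 0).
  apply: linear_ex => a u v; rewrite -linearP; congr (h _).
  by apply/pair_equal_spec; rewrite /= scaler0 addr0.
have [h2 h2E] : exists h2 : {linear Q -> N}, h2 =1 fun x => h (0, x).
  apply: linear_ex => a u v; rewrite -linearP; congr (h _).
  by apply/pair_equal_spec; rewrite /= scaler0 addr0.
have [k1 k1E] := pP _ _ g h1 gS; have [k2 k2E] := pQ _ _ g h2 gS.
have [k kE] : exists k : {linear (P * Q)%type -> M},
    k =1 fun x => k1 x.1 + k2 x.2.
  by apply: linear_ex => a u v /=; rewrite !linearP scalerDr addrACA.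
exists k => -[x y]; rewrite kE raddfD /= k1E k2E h1E h2E -raddfD.
by congr (h _); apply/pair_equal_spec; rewrite /= addr0 add0r.
Qed.

Definition fgproj_sum (P Q : fgproj) : fgproj :=
  FGProj (fin_gen_prod (fgproj_fin_gen P) (fgproj_fin_gen Q))
         (projective_prod (@fgproj_projective P) (@fgproj_projective Q)).

Lemma fin_gen0 : fin_gen 'rV[R]_0.
Proof.
exists 0%N, (fun _ => 0) => x; exists (fun _ => 0).
by rewrite big_ord0; apply/rowP => -[].
Qed.

Lemma projective0 : projective 'rV[R]_0.
Proof.
move=> M N g h _.
have [k kE] : exists k : {linear 'rV[R]_0 -> M}, k =1 fun _ => 0.
  by apply: linear_ex => a u v; rewrite scaler0 addr0.
exists k => x; rewrite kE raddf0; have -> : x = 0 by apply/rowP => -[].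
by rewrite raddf0.
Qed.

Definition fgproj0 : fgproj := FGProj fin_gen0 projective0.

Definition has_IBN : Prop :=
  forall p q : nat, mod_iso 'rV[R]_p 'rV[R]_q -> p = q.

End Modules.

(* The type of equivalence classes of [r], as predicates.  The type of all
   finitely generated projective [R]-modules lives in a universe strictly above
   those of the carriers of [zmodType] and [eqType], so [{eq_quot _}] does not
   apply to it, and [K0] below cannot carry a [zmodType] structure: its group
   law is [K0_add]. *)

Definition quot (T : Type) (r : T -> T -> Prop) : Type :=
  {C : T -> Prop | exists x, C = r x}.

Section Quot.
Variables (T : Type) (r : T -> T -> Prop).

Definition cls (x : T) : quot r := exist _ (r x) (ex_intro _ x erefl).

Definition rep (C : quot r) : T := sval (cid (svalP C)).

Lemma quot_inj (C D : quot r) : sval C = sval D -> C = D.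
Proof. by case: C D => [C c] [D d]; exact: eq_exist. Qed.

Lemma repK C : cls (rep C) = C.
Proof. by apply: quot_inj; rewrite /rep; case: cid => x /= ->. Qed.

Hypotheses (r_refl : forall x, r x x) (r_sym : forall x y, r x y -> r y x).
Hypothesis r_trans : forall x y z, r x y -> r y z -> r x z.

Lemma cls_eq x y : cls x = cls y <-> r x y.
Proof.
split=> [|rxy].
  by move/(congr1 sval) => /= ->; exact: r_refl.
apply: quot_inj => /=; apply: funext => z; apply: propext.
by split; apply: r_trans; [exact: r_sym|].
Qed.

Lemma rep_cls x : r (rep (cls x)) x.
Proof. by apply/cls_eq; rewrite repK. Qed.

End Quot.

Section Grothendieck.
Variables (M : Type) (op : M -> M -> M).

(* The pair [(a, b)] stands for the formal difference [a - b]. *)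
Definition groth_rel (x y : M * M) : Prop :=
  exists e, op (op x.1 y.2) e = op (op y.1 x.2) e.

Definition groth : Type := quot groth_rel.

Definition groth_add (x y : groth) : groth :=
  cls groth_rel (op (rep x).1 (rep y).1, op (rep x).2 (rep y).2).

Definition groth_opp (x : groth) : groth :=
  cls groth_rel ((rep x).2, (rep x).1).

Variable e0 : M.
Definition groth0 : groth := cls groth_rel (e0, e0).

Hypotheses (opA : associative op) (opC : commutative op).
Hypothesis op0 : left_id e0 op.

Let opAC x y z : op (op x y) z = op (op x z) y.
Proof. by rewrite -!opA (opC y). Qed.

Let opACA x y z t : op (op x y) (op z t) = op (op x z) (op y t).
Proof. by rewrite !opA (opAC x). Qed.

Lemma groth_refl x : groth_rel x x. Proof. by exists e0. Qed.

Lemma groth_sym x y : groth_rel x y -> groth_rel y x.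
Proof. by case=> e ?; exists e. Qed.

Lemma groth_trans x y z : groth_rel x y -> groth_rel y z -> groth_rel x z.
Proof.
case=> e E [f F]; exists (op (op y.1 y.2) (op e f)).
have -> : op (op x.1 z.2) (op (op y.1 y.2) (op e f)) =
          op (op (op x.1 y.2) e) (op (op y.1 z.2) f).
  by rewrite (opC y.1 y.2) [in LHS](opACA y.2) opACA (opA x.1) (opA z.2) (opC z.2).
by rewrite E F opACA (opC (op y.1 _)) (opC y.1 x.2) (opACA z.1) (opC y.2) -opA.
Qed.

Lemma groth_cls_eq x y :
  cls groth_rel x = cls groth_rel y <-> groth_rel x y.
Proof. exact: (cls_eq groth_refl groth_sym groth_trans). Qed.

Lemma groth_rel_add x x' y y' : groth_rel x x' -> groth_rel y y' ->
  groth_rel (op x.1 y.1, op x.2 y.2) (op x'.1 y'.1, op x'.2 y'.2).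
Proof.
case=> e E [f F]; exists (op e f) => /=.
by rewrite (opACA x.1) (opACA x'.1) opACA E F -opACA.
Qed.

Lemma groth_addE x y :
  groth_add (cls groth_rel x) (cls groth_rel y) =
  cls groth_rel (op x.1 y.1, op x.2 y.2).
Proof.
apply/groth_cls_eq/groth_rel_add;
  exact: (rep_cls groth_refl groth_sym groth_trans).
Qed.

Lemma groth_oppE x :
  groth_opp (cls groth_rel x) = cls groth_rel (x.2, x.1).
Proof.
apply/groth_cls_eq.
case: (rep_cls groth_refl groth_sym groth_trans x) => e E.
by exists e; rewrite /= (opC _ x.1) (opC x.2) E.
Qed.

Lemma groth_addA : associative groth_add.
Proof.
move=> x y z; rewrite -(repK x) -(repK y) -(repK z) !groth_addE /=.
by rewrite !opA.
Qed.

Lemma groth_addC : commutative groth_add.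
Proof.
move=> x y; rewrite -(repK x) -(repK y) !groth_addE.
by congr (cls _ (_, _)); exact: opC.
Qed.

Lemma groth_add0 : left_id groth0 groth_add.
Proof. by move=> x; rewrite -(repK x) groth_addE /= !op0; case: (rep x). Qed.

Lemma groth_addN : left_inverse groth0 groth_opp groth_add.
Proof.
move=> x; rewrite -(repK x) groth_oppE groth_addE.
by apply/groth_cls_eq; exists e0; rewrite /= (opC (rep x).2) !(opC _ e0) !op0.
Qed.

End Grothendieck.

Section K0.
Variable R : pzRingType.

Definition fgproj_iso (P Q : fgproj R) : Prop := mod_iso P Q.

Definition isoclass : Type := quot fgproj_iso.

Definition isoclass_add (a b : isoclass) : isoclass :=
  cls fgproj_iso (fgproj_sum (rep a) (rep b)).

Definition isoclass0 : isoclass := cls fgproj_iso (fgproj0 R).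

Lemma isoclass_eq (P Q : fgproj R) :
  cls fgproj_iso P = cls fgproj_iso Q <-> mod_iso P Q.
Proof.
apply: cls_eq => [S|S T|S T U]; rewrite /fgproj_iso.
- exact: mod_iso_refl.
- exact: mod_iso_sym.
- exact: mod_iso_trans.
Qed.

Lemma isoclass_addE (P Q : fgproj R) :
  isoclass_add (cls fgproj_iso P) (cls fgproj_iso Q) =
  cls fgproj_iso (fgproj_sum P Q).
Proof.
have repP S : mod_iso (rep (cls fgproj_iso S)) S.
  by apply/isoclass_eq; rewrite repK.
by rewrite /isoclass_add; apply/isoclass_eq; exact: mod_iso_prod.
Qed.

Lemma isoclass_addA : associative isoclass_add.
Proof.
move=> a b c; rewrite -(repK a) -(repK b) -(repK c) !isoclass_addE.
by apply/isoclass_eq; exact: mod_iso_prodA.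
Qed.

Lemma isoclass_addC : commutative isoclass_add.
Proof.
move=> a b; rewrite -(repK a) -(repK b) !isoclass_addE.
by apply/isoclass_eq; exact: mod_iso_prodC.
Qed.

Lemma isoclass_add0 : left_id isoclass0 isoclass_add.
Proof.
move=> a; rewrite -(repK a) isoclass_addE; apply/isoclass_eq => /=.
have [h hE] : exists h : {linear ('rV[R]_0 * rep a)%type -> rep a},
    h =1 snd by apply: linear_ex.
exists h; exists (fun x => (0, x)) => [[u x]|x]; rewrite hE //=.
by congr pair; apply/rowP => -[].
Qed.

Definition K0 : Type := groth isoclass_add.
Definition K0_add : K0 -> K0 -> K0 := @groth_add _ isoclass_add.
Definition K0_opp : K0 -> K0 := @groth_opp _ isoclass_add.
Definition K0_zero : K0 := groth0 isoclass_add isoclass0.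

Lemma K0_addA : associative K0_add.
Proof. exact: groth_addA isoclass0 isoclass_addA isoclass_addC. Qed.

Lemma K0_addC : commutative K0_add.
Proof. exact: groth_addC isoclass0 isoclass_addA isoclass_addC. Qed.

Lemma K0_add0 : left_id K0_zero K0_add.
Proof. exact: groth_add0 isoclass_addA isoclass_addC isoclass_add0. Qed.

Lemma K0_addN : left_inverse K0_zero K0_opp K0_add.
Proof. exact: groth_addN isoclass_addA isoclass_addC isoclass_add0. Qed.

End K0.

Section DirectLimit.
Variables (A : nat -> pzRingType) (phi : forall k, {rmorphism A k -> A k.+1}).

Definition dl_pre : Type := {k : nat & A k}.
HB.instance Definition _ := Choice.on dl_pre.

Definition dl_step (x : dl_pre) : dl_pre :=
  Tagged (fun k => A k) (phi (tag x) (tagged x)).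

(* The eventual-equality relation on the disjoint union of the [A k]: [d] and
   [e] steps bring [x] and [y] to the same level. *)
Definition dl_rel (x y : dl_pre) : bool :=
  `[< exists d e, iter d dl_step x = iter e dl_step y >].

Lemma dl_rel_refl : reflexive dl_rel.
Proof. by move=> x; apply/asboolP; exists 0%N, 0%N. Qed.

Lemma dl_rel_sym : symmetric dl_rel.
Proof.
by move=> x y; apply/asboolP/asboolP => -[d [e E]]; exists e, d.
Qed.

Lemma dl_rel_trans : transitive dl_rel.
Proof.
move=> y x z /asboolP[d [e E]] /asboolP[f [g F]]; apply/asboolP.
by exists (f + d)%N, (e + g)%N; rewrite !iterD E -F -!iterD addnC.
Qed.

Canonical dl_equiv := EquivRel dl_rel dl_rel_refl dl_rel_sym dl_rel_trans.

Definition dirlim : Type := {eq_quot dl_equiv}.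
HB.instance Definition _ := Choice.on dirlim.

Definition dl_in k (a : A k) : dirlim :=
  \pi_{eq_quot dl_equiv} (Tagged (fun k => A k) a).

(* The image in [A m] of an element [x] of level at most [m]; the value [0] is
   never reached below, where [dl_lev] is only used for [tag x <= m]. *)
Definition dl_lev m (x : dl_pre) : A m :=
  tagged_as (Tagged (fun k => A k) (0 : A m)) (iter (m - tag x) dl_step x).

Definition dl_op2 (f : forall k, A k -> A k -> A k) (u v : dirlim) : dirlim :=
  let x : dl_pre := repr u in let y : dl_pre := repr v in
  let m := maxn (tag x) (tag y) in dl_in (f m (dl_lev m x) (dl_lev m y)).

Definition dl_zero : dirlim := dl_in (0 : A 0).
Definition dl_one : dirlim := dl_in (1 : A 0).
Definition dl_opp (u : dirlim) : dirlim :=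
  let x : dl_pre := repr u in dl_in (- tagged x).
Definition dl_add := dl_op2 (fun k => @GRing.add (A k)).
Definition dl_mul := dl_op2 (fun k => @GRing.mul (A k)).

Lemma dl_Tagged_inj k (a b : A k) :
  Tagged (fun k => A k) a = Tagged (fun k => A k) b -> a = b.
Proof. exact: (@eq_from_Tagged _ (fun k => A k : Type)). Qed.

Lemma tag_iter_step d (x : dl_pre) : tag (iter d dl_step x) = (d + tag x)%N.
Proof. by elim: d => //= d ->. Qed.

Lemma dl_levP m (x : dl_pre) : (tag x <= m)%N ->
  Tagged (fun k => A k) (dl_lev m x) = iter (m - tag x) dl_step x.
Proof.
move=> xm; rewrite /dl_lev.
have : tag (iter (m - tag x) dl_step x) = m by rewrite tag_iter_step subnK.
move: (iter _ _ _) => -[k a] /= E; move: a; rewrite E => a.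
by rewrite /tagged_as /=; case: eqP => // E'; rewrite (eq_axiomK E').
Qed.

Lemma dl_lev_tag m (a : A m) : dl_lev m (Tagged (fun k => A k) a) = a.
Proof. by apply: dl_Tagged_inj; rewrite dl_levP //= subnn. Qed.

Lemma dl_levS m (x : dl_pre) : (tag x <= m)%N ->
  dl_lev m.+1 x = phi m (dl_lev m x).
Proof.
move=> xm; apply: dl_Tagged_inj; rewrite dl_levP ?leqW // subSn //= -dl_levP //.
Qed.

Lemma dl_inS k (a : A k) : dl_in (phi k a) = dl_in a.
Proof. by apply/eqmodP/asboolP; exists 0%N, 1%N. Qed.

Lemma dl_in_lev m (x : dl_pre) : (tag x <= m)%N ->
  dl_in (dl_lev m x) = \pi_{eq_quot dl_equiv} x.
Proof.
move=> xm; apply/eqmodP/asboolP; exists 0%N, (m - tag x)%N => /=.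
exact: dl_levP.
Qed.

Lemma dl_lev_eq (x y : dl_pre) : dl_rel x y ->
  exists N, [/\ (tag x <= N)%N, (tag y <= N)%N &
    forall m, (N <= m)%N -> dl_lev m x = dl_lev m y].
Proof.
case/asboolP=> d [e E]; have := congr1 tag E; rewrite !tag_iter_step => t.
have xN : (tag x <= d + tag x)%N by exact: leq_addl.
have yN : (tag y <= d + tag x)%N by rewrite t leq_addl.
exists (d + tag x)%N; split=> // m Nm.
apply: dl_Tagged_inj; rewrite !dl_levP ?(leq_trans _ Nm) //.
have -> : (m - tag x = (m - (d + tag x)) + d)%N.
  by rewrite subnDA subnAC subnK // leq_subRL ?(leq_trans xN Nm) // addnC.
rewrite iterD E -iterD; congr iter.
by rewrite t subnDA subnAC subnK // leq_subRL ?(leq_trans yN Nm) // addnC -t.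
Qed.

(* Two elements of the same level are identified in the limit exactly when
   they become equal at some later level. *)
Lemma dl_in_eq k (a b : A k) : dl_in a = dl_in b <->
  exists d, iter d dl_step (Tagged (fun k => A k) a) =
            iter d dl_step (Tagged (fun k => A k) b).
Proof.
split=> [/eqmodP/asboolP[d [e E]]|[d E]]; last first.
  by apply/eqmodP/asboolP; exists d, d.
exists d; have := congr1 tag E; rewrite !tag_iter_step /= => /addIn t.
by rewrite {2}t.
Qed.

Lemma dl_inP (u : dirlim) : exists k (a : A k), u = dl_in a.
Proof.
by exists (tag (repr u)), (tagged (repr u)); rewrite /dl_in taggedK reprK.
Qed.

Lemma dl_in_le k m (a : A k) : (k <= m)%N -> exists b : A m, dl_in a = dl_in b.
Proof.
by move=> km; exists (dl_lev m (Tagged (fun k => A k) a)); rewrite dl_in_lev.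
Qed.

Lemma dl_in3P (u v w : dirlim) : exists k (a b c : A k),
  [/\ u = dl_in a, v = dl_in b & w = dl_in c].
Proof.
have [i [a ->]] := dl_inP u; have [j [b ->]] := dl_inP v.
have [k [c ->]] := dl_inP w.
have [a' ->] := dl_in_le a (leq_addr (j + k) i).
have [b' ->] := dl_in_le b (leq_trans (leq_addr k j) (leq_addl i _)).
have [c' ->] := dl_in_le c (leq_trans (leq_addl j k) (leq_addl i _)).
by exists (i + (j + k))%N, a', b', c'.
Qed.

Lemma dl_op2E (f : forall k, A k -> A k -> A k)
    (fS : forall k a b, phi k (f k a b) = f k.+1 (phi k a) (phi k b))
    k (a b : A k) : dl_op2 f (dl_in a) (dl_in b) = dl_in (f k a b).
Proof.
have up x y i j : (tag x <= i)%N -> (tag y <= i)%N -> (i <= j)%N ->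
    dl_in (f i (dl_lev i x) (dl_lev i y)) =
    dl_in (f j (dl_lev j x) (dl_lev j y)).
  move=> xi yi /subnK <-; elim: (j - i)%N => //= d ->.
  have id : (i <= d + i)%N by exact: leq_addl.
  by rewrite addSn !dl_levS ?(leq_trans _ id) // -fS dl_inS.
rewrite /dl_op2; set x : dl_pre := repr _; set y : dl_pre := repr _.
have rx : dl_rel x (Tagged (fun k => A k) a).
  by apply/eqmodP; rewrite reprK.
have ry : dl_rel y (Tagged (fun k => A k) b).
  by apply/eqmodP; rewrite reprK.
have [N [xN /= kN xE]] := dl_lev_eq rx; have [N' [yN' /= kN' yE]] := dl_lev_eq ry.
pose m := maxn N N'.
have Nm : (N <= m)%N by exact: leq_maxl.
have N'm : (N' <= m)%N by exact: leq_maxr.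
rewrite (up x y _ m) ?leq_maxl ?leq_maxr //; last first.
  by rewrite geq_max (leq_trans xN Nm) (leq_trans yN' N'm).
rewrite xE // yE // -(up _ _ k m) ?dl_lev_tag //.
exact: leq_trans Nm.
Qed.

Lemma dl_inD k (a b : A k) : dl_add (dl_in a) (dl_in b) = dl_in (a + b).
Proof. by apply: dl_op2E => {}k {}a {}b; rewrite rmorphD. Qed.

Lemma dl_inM k (a b : A k) : dl_mul (dl_in a) (dl_in b) = dl_in (a * b).
Proof. by apply: dl_op2E => {}k {}a {}b; rewrite rmorphM. Qed.

Lemma dl_in0 k : dl_in (0 : A k) = dl_zero.
Proof. by elim: k => // k <-; rewrite -(rmorph0 (phi k)) dl_inS. Qed.

Lemma dl_in1 k : dl_in (1 : A k) = dl_one.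
Proof. by elim: k => // k <-; rewrite -(rmorph1 (phi k)) dl_inS. Qed.

Lemma dl_addA : associative dl_add.
Proof.
move=> u v w; have [k [a [b [c [-> -> ->]]]]] := dl_in3P u v w.
by rewrite !dl_inD addrA.
Qed.

Lemma dl_addC : commutative dl_add.
Proof.
move=> u v; have [k [a [b [_ [-> -> _]]]]] := dl_in3P u v u.
by rewrite !dl_inD addrC.
Qed.

Lemma dl_add0 : left_id dl_zero dl_add.
Proof.
by move=> u; have [k [a ->]] := dl_inP u; rewrite -(dl_in0 k) dl_inD add0r.
Qed.

Lemma dl_addN : left_inverse dl_zero dl_opp dl_add.
Proof.
move=> u; rewrite -[in X in dl_add _ X](reprK u) /dl_opp.
case: (repr u) => k a; rewrite -/(dl_in a) dl_inD /= addNr; exact: dl_in0.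
Qed.

HB.instance Definition _ :=
  GRing.isZmodule.Build dirlim dl_addA dl_addC dl_add0 dl_addN.

Lemma dl_in_zmod k : zmod_morphism (@dl_in k).
Proof.
have inN (a : A k) : dl_in (- a) = - dl_in a.
  by apply: (addrI (dl_in a)); rewrite subrr; apply: etrans (dl_inD _ _) _;
    rewrite subrr dl_in0.
by move=> a b; rewrite -inN; exact: esym (dl_inD _ _).
Qed.

HB.instance Definition _ k :=
  GRing.isZmodMorphism.Build (A k) dirlim (@dl_in k) (@dl_in_zmod k).

Lemma dl_mulA : associative dl_mul.
Proof.
move=> u v w; have [k [a [b [c [-> -> ->]]]]] := dl_in3P u v w.
by rewrite !dl_inM mulrA.
Qed.

Lemma dl_mul1 : left_id dl_one dl_mul.
Proof.
by move=> u; have [k [a ->]] := dl_inP u; rewrite -(dl_in1 k) dl_inM mul1r.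
Qed.

Lemma dl_mulr1 : right_id dl_one dl_mul.
Proof.
by move=> u; have [k [a ->]] := dl_inP u; rewrite -(dl_in1 k) dl_inM mulr1.
Qed.

Lemma dl_mulDl : left_distributive dl_mul +%R.
Proof.
move=> u v w; have [k [a [b [c [-> -> ->]]]]] := dl_in3P u v w.
by rewrite -raddfD !dl_inM -raddfD mulrDl.
Qed.

Lemma dl_mulDr : right_distributive dl_mul +%R.
Proof.
move=> u v w; have [k [a [b [c [-> -> ->]]]]] := dl_in3P u v w.
by rewrite -raddfD !dl_inM -raddfD mulrDr.
Qed.

HB.instance Definition _ := GRing.Zmodule_isPzRing.Build dirlim
  dl_mulA dl_mul1 dl_mulr1 dl_mulDl dl_mulDr.

Lemma dl_in_monoid k : monoid_morphism (@dl_in k).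
Proof. by split=> [|a b]; [exact: dl_in1|rewrite -dl_inM]. Qed.

HB.instance Definition _ k :=
  GRing.isMonoidMorphism.Build (A k) dirlim (@dl_in k) (@dl_in_monoid k).

End DirectLimit.

Section MatricialClosure.
Variables (n : nat) (R : pzRingType).

Lemma sum_expn k : (\sum_(i < n) n ^ k)%N = (n ^ k.+1)%N.
Proof. by rewrite sum_nat_const card_ord expnS. Qed.

Definition MC_map k (B : 'M[R]_(n ^ k)) : 'M[R]_(n ^ k.+1) :=
  castmx (sum_expn k, sum_expn k) (\mxdiag_(i < n) B).

Lemma MC_map_is_zmod_morphism k : zmod_morphism (@MC_map k).
Proof.
by move=> B C; rewrite /MC_map mxdiagB; case: _ / (sum_expn k).
Qed.

Lemma MC_map_is_monoid_morphism k : monoid_morphism (@MC_map k).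
Proof.
split=> [|B C]; rewrite /MC_map.
  rewrite -[1 : 'M_(n ^ k)]/(1%:M) mxdiagZ; by case: _ / (sum_expn k).
have <- : \mxdiag_(i < n) B *m \mxdiag_(i < n) C = \mxdiag_(i < n) (B *m C).
  rewrite [X in _ *m X]/mxdiag mul_mxdiag_mxblock; apply/eq_mxblock => i j.
  by case: eqVneq => [e|_]; rewrite ?mulmx0 // !conform_mx_id.
by case: _ / (sum_expn k).
Qed.

HB.instance Definition _ k :=
  GRing.isZmodMorphism.Build _ _ (@MC_map k) (@MC_map_is_zmod_morphism k).
HB.instance Definition _ k :=
  GRing.isMonoidMorphism.Build _ _ (@MC_map k) (@MC_map_is_monoid_morphism k).

Definition MC : pzRingType :=
  @dirlim (fun k => 'M[R]_(n ^ k)) (fun k => @MC_map k).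

End MatricialClosure.

Section Zinv.
Variable n : nat.

(* The intersection of the subrings of [rat] containing [1 / n]. *)
Definition Zinv_pred : pred rat := fun x =>
  `[< forall S : {pred rat}, subring_closed S -> n%:R^-1 \in S -> x \in S >].

Lemma Zinv_zmod_closed : zmod_closed Zinv_pred.
Proof.
split=> [|x y /asboolP xP /asboolP yP]; apply/asboolP => S Sr nS.
  exact: (GRing.subring_closedB Sr).1.
by apply: (GRing.subring_closedB Sr).2; [exact: xP|exact: yP].
Qed.

HB.instance Definition _ := GRing.isZmodClosed.Build rat Zinv_pred
  Zinv_zmod_closed.

Record Zinv := MkZinv { Zinv_val :> rat; _ : Zinv_val \in Zinv_pred }.
HB.instance Definition _ := [isSub for Zinv_val].
HB.instance Definition _ := [Choice of Zinv by <:].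
HB.instance Definition _ := [SubChoice_isSubZmodule of Zinv by <:].

End Zinv.

(* Main.v *)
Require Import Defs.
From HB Require Import structures.
From mathcomp Require Import all_boot all_order all_algebra.
From mathcomp Require Import boolp ring.
Set Implicit Arguments.
Unset Strict Implicit.
Unset Printing Implicit Defensive.
Import Order.TTheory GRing.Theory Num.Theory.
Local Open Scope ring_scope.

(* A finitely generated projective module over MC_n(K) is the row space of an
   idempotent matrix E with entries in MC_n(K), and E already lives over some
   M_{n^k}(K), where flattening the blocks turns it into an idempotent over K,
   of rank r say.  Passing from k to k + 1 multiplies r by n, so the number
   r / n^k depends on the module only; since idempotents over a field are
   equivalent as soon as they have the same rank, it determines the module up
   to isomorphism.  It is additive, takes all values r / n^k, and sends the free
   module of rank p to p: the first facts identify K_0 with Z[1/n], the last one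
   gives the invariant basis number. *)

(** * The row space of an idempotent matrix *)

Section IdempotentModule.
Variables (R : pzRingType) (m : nat) (E : 'M[R]_m).

(** For idempotent [E] these rows make up its row space; the equation expresses membership as a
    boolean. *)
Definition fixed_rows : pred 'rV[R]_m := fun x => x *m E == x.

Lemma fixed_rows_submod_closed : submod_closed fixed_rows.
Proof.
split=> [|a x y]; first by rewrite unfold_in /fixed_rows mul0mx.
by move=> /eqP xE /eqP yE; apply/eqP; rewrite mulmxDl -scalemxAl xE yE.
Qed.

HB.instance Definition _ :=
  GRing.isSubmodClosed.Build R 'rV[R]_m fixed_rows fixed_rows_submod_closed.

Record idem_mod := IdemMod {
  idem_row :> 'rV[R]_m; _ : idem_row \in fixed_rows }.
HB.instance Definition _ := [isSub for idem_row].
HB.instance Definition _ := [Choice of idem_mod by <:].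
HB.instance Definition _ := [SubChoice_isSubLmodule of idem_mod by <:].

End IdempotentModule.

(** * Finitely generated projective modules as idempotent matrices *)

Section Presentations.
Variable R : pzRingType.
Implicit Types P Q : lmodType R.

Definition dual_basis P m (s : 'I_m -> P) (h : {linear P -> 'rV[R]_m}) : Prop :=
  forall x, x = \sum_i h x 0 i *: s i.

(* [P] is isomorphic to the row space of the idempotent matrix [E]. *)
Definition presents P m (E : 'M[R]_m) : Prop :=
  exists s (h : {linear P -> 'rV[R]_m}),
    dual_basis s h /\ E = \matrix_i h (s i).

Lemma linear_comb P Q m (c : 'rV[R]_m) (s : 'I_m -> P) p
    (h : {linear P -> 'rV[R]_p}) :
  h (\sum_i c 0 i *: s i) = c *m \matrix_i h (s i).
Proof.
rewrite raddf_sum /= mulmx_sum_row; apply: eq_bigr => i _.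
by rewrite linearZ rowK.
Qed.

Lemma linear_sum_ex P m (c : {linear P -> 'rV[R]_m}) Q (t : 'I_m -> Q) :
  exists f : {linear P -> Q}, forall x, f x = \sum_i c x 0 i *: t i.
Proof.
apply: (@linear_ex _ _ _ (fun x => \sum_i c x 0 i *: t i)) => a u v.
rewrite scaler_sumr -big_split; apply: eq_bigr => i _ /=.
by rewrite linearP !mxE scalerDl scalerA.
Qed.

Lemma dual_basis_gram P m (s : 'I_m -> P) (h : {linear P -> 'rV[R]_m}) x :
  dual_basis s h -> h x *m (\matrix_i h (s i)) = h x.
Proof. by move=> sh; rewrite [in RHS](sh x) linear_comb. Qed.

Lemma presents_idem P m (E : 'M[R]_m) : presents P E -> E *m E = E.
Proof.
case=> s [h [sh ->]]; apply/row_matrixP => i.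
by rewrite row_mul !rowK (dual_basis_gram _ sh).
Qed.

(** The generators give a surjection from a free module; projectivity splits it, and the section
    supplies the coordinate map. *)
Lemma presents_fgproj (P : fgproj R) : exists m (E : 'M[R]_m), presents P E.
Proof.
have [m [s sP]] := fgproj_fin_gen P.
have [g gE] := linear_sum_ex (@idfun 'rV[R]_m) s.
have gS y : exists x, g x = y.
  have [c ->] := sP y; exists (\row_i c i); rewrite gE.
  by apply: eq_bigr => i _; rewrite mxE.
have [h hE] := @fgproj_projective R P _ _ g idfun gS.
exists m, (\matrix_i h (s i)), s, h; split=> // x.
by rewrite -[LHS]hE gE.
Qed.

Lemma presents_fin_gen P m (E : 'M[R]_m) : presents P E -> fin_gen P.
Proof. by case=> s [h [sh _]]; exists m, s => x; exists (h x 0). Qed.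

Lemma presents_projective P m (E : 'M[R]_m) : presents P E -> projective P.
Proof.
case=> s [h [sh _]] M N g f gS.
pose y i := sval (cid (gS (f (s i)))).
have [k kE] := linear_sum_ex h y.
exists k => x; rewrite kE [in RHS](sh x) !raddf_sum; apply: eq_bigr => i _ /=.
by rewrite !linearZ; congr (_ *: _); rewrite /y; case: cid.
Qed.

Lemma presents_iso P Q m (E : 'M[R]_m) :
  mod_iso P Q -> presents P E -> presents Q E.
Proof.
case=> f [f' fK f'K] [s [h [sh ->]]].
have [g gE] : exists g : {linear Q -> 'rV[R]_m}, g =1 h \o f'.
  have lf' : linear f' by move=> a u v; apply: (can_inj fK); rewrite linearP !f'K.
  by apply: linear_ex => a u v /=; rewrite lf' linearP.
exists (f \o s), g; split=> [x|].
  rewrite -[LHS]f'K [in LHS](sh (f' x)) raddf_sum; apply: eq_bigr => i _ /=.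
  by rewrite linearZ gE.
by apply/row_matrixP => i; rewrite !rowK gE /= fK.
Qed.

(** [X] and [Y] express the generators of each presentation in the coordinates of the other. *)
Lemma presents_equiv P m p (E : 'M[R]_m) (F : 'M[R]_p) :
  presents P E -> presents P F ->
  exists (X : 'M[R]_(m, p)) (Y : 'M[R]_(p, m)), X *m Y = E /\ Y *m X = F.
Proof.
case=> s [h [sh ->]] [t [g [tg ->]]].
exists (\matrix_i g (s i)), (\matrix_j h (t j)).
by split; apply/row_matrixP => i; rewrite row_mul !rowK -linear_comb -?tg -?sh.
Qed.

(** Converse of [presents_equiv]: multiplying coordinate rows by [X] and by [Y] induces mutually
    inverse maps. *)
Lemma equiv_mod_iso P Q m p (E : 'M[R]_m) (F : 'M[R]_p)
    (X : 'M[R]_(m, p)) (Y : 'M[R]_(p, m)) :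
  presents P E -> presents Q F -> X *m Y = E -> Y *m X = F -> mod_iso P Q.
Proof.
case=> s [h [sh EE]] [t [g [tg FE]]] XY YX.
have [a aE] : exists f : {linear P -> 'rV[R]_p}, forall x, f x = h x *m X.
  by apply: linear_ex => c u v; rewrite linearP mulmxDl scalemxAl.
have [b bE] : exists f : {linear Q -> 'rV[R]_m}, forall x, f x = g x *m Y.
  by apply: linear_ex => c u v; rewrite linearP mulmxDl scalemxAl.
have [f fE] := linear_sum_ex a t; have [f' f'E] := linear_sum_ex b s.
have hE x : h x *m E = h x by rewrite EE (dual_basis_gram _ sh).
have gE x : g x *m F = g x by rewrite FE (dual_basis_gram _ tg).
exists f; exists f' => x.
  rewrite f'E [RHS](sh x); apply: eq_bigr => i _; congr (_ 0 i *: _).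
  (* The coordinates have become [h x *m X *m F *m Y]. As [F] is [Y *m X], this is [h x *m E *m E],
     and [E] fixes [h x]. *)
  rewrite bE fE linear_comb // -FE aE -YX !mulmxA -(mulmxA (h x)) XY hE.
  by rewrite -mulmxA XY hE.
rewrite fE [RHS](tg x); apply: eq_bigr => i _; congr (_ 0 i *: _).
rewrite aE f'E linear_comb // -EE bE -XY !mulmxA -(mulmxA (g x)) YX gE.
by rewrite -mulmxA YX gE.
Qed.

Lemma presents_prod P Q m p (E : 'M[R]_m) (F : 'M[R]_p) :
  presents P E -> presents Q F -> presents (P * Q)%type (block_mx E 0 0 F).
Proof.
case=> s [h [sh ->]] [t [g [tg ->]]].
have [k kE] : exists k : {linear (P * Q)%type -> 'rV[R]_(m + p)},
    forall x, k x = row_mx (h x.1) (g x.2).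
  by apply: linear_ex => a u v; rewrite !linearP scale_row_mx add_row_mx.
pose u i : (P * Q)%type :=
  match split i with inl j => (s j, 0) | inr j => (0, t j) end.
have ul i : u (lshift p i) = (s i, 0) by rewrite /u (unsplitK (inl i)).
have ur i : u (rshift m i) = (0, t i) by rewrite /u (unsplitK (inr i)).
exists u, k; split=> [[x y]|].
  rewrite kE /= big_split_ord /=.
  rewrite (eq_bigr (fun i => (h x 0 i *: s i, 0))); last first.
    by move=> i _; rewrite ul row_mxEl; congr pair; exact: scaler0.
  rewrite [X in _ + X](eq_bigr (fun i => (0, g y 0 i *: t i))); last first.
    by move=> i _; rewrite ur row_mxEr; congr pair; exact: scaler0.
  by rewrite !sum_pair !big1_eq -sh -tg; congr pair; rewrite ?addr0 ?add0r.
apply/row_matrixP => i; rewrite rowK -[i]splitK; case: split => j /=.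
  by rewrite ul kE /= raddf0 /block_mx rowKu row_row_mx rowK !raddf0.
by rewrite ur kE /= raddf0 /block_mx rowKd row_row_mx rowK !raddf0.
Qed.

Lemma presents_free p : presents 'rV[R]_p (1%:M : 'M[R]_p).
Proof.
exists (fun i => delta_mx 0 i), idfun; split=> [x|]; first exact: row_sum_delta.
by apply/row_matrixP => i; rewrite rowK row1.
Qed.

(** The rows of [E] serve as generators and the inclusion as coordinate map: a row fixed by [E]
    combines the rows of [E] with its own entries as coefficients. *)
Lemma presents_ex m (E : 'M[R]_m) : E *m E = E ->
  exists P : lmodType R, presents P E.
Proof.
move=> EE; exists (idem_mod E).
have fixE i : row i E \in fixed_rows E.
  by rewrite unfold_in /fixed_rows -row_mul EE.
have [h hE] : exists h : {linear idem_mod E -> 'rV[R]_m}, forall x, h x = val x.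
  by apply: linear_ex => a u v; rewrite linearP.
exists (fun i => IdemMod (fixE i)), h; split=> [x|].
  apply: val_inj; rewrite raddf_sum /=; case: x => x xE; rewrite hE /=.
  by rewrite -[LHS](eqP xE) mulmx_sum_row.
by apply/row_matrixP => i; rewrite rowK hE.
Qed.

End Presentations.

(** * Elements of a direct limit *)

Lemma dl_in_inj (A : nat -> pzRingType)
    (phi : forall k, {rmorphism A k -> A k.+1}) :
  (forall k, injective (phi k)) -> forall k, injective (@dl_in A phi k).
Proof.
move=> phi_inj k a b /dl_in_eq[d].
(* One step is injective even across levels, so the [d] common steps are cancelled one at a time. *)
have stepI : injective (dl_step phi).
  move=> [i x] [j y] E; have := congr1 tag E => -[] /= ij; case: _ / ij in y E *.
  by congr Tagged; apply: phi_inj; exact: dl_Tagged_inj E.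
by elim: d => [|d IH] /=; [exact: dl_Tagged_inj|move/stepI].
Qed.

(** The maximum of the levels serves all the elements. Allowing every later level lets several
    families be brought to one level. *)
Lemma dl_in_fin (A : nat -> pzRingType)
    (phi : forall k, {rmorphism A k -> A k.+1}) (I : finType) (u : I -> dirlim phi) :
  exists k0, forall k, (k0 <= k)%N ->
    exists a : I -> A k, forall i, u i = dl_in phi (a i).
Proof.
pose lev i := sval (cid (dl_inP (u i))).
exists (\max_i lev i) => k lek.
have ex i : {a : A k | u i = dl_in phi a}.
  apply: cid; move: (leq_trans (leq_bigmax i) lek); rewrite /lev.
  by case: cid => l [a ua] /= lk; rewrite ua; exact: dl_in_le.
by exists (fun i => sval (ex i)) => i; exact: svalP (ex i).
Qed.

(** * Idempotents and block copies over a field *)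

Section BlockMatrices.
Variable K : fieldType.

(** In a rank factorisation, [A *m (B *m A) *m B = A *m B]; full column rank of [A] and full row
    rank of [B] allow both to be cancelled. *)
Lemma idem_factor m (E : 'M[K]_m) : E *m E = E ->
  exists r (A : 'M[K]_(m, r)) (B : 'M[K]_(r, m)), E = A *m B /\ B *m A = 1%:M.
Proof.
move=> EE; exists (\rank E), (col_base E), (row_base E).
split; first by rewrite mulmx_base.
move: (mulmx_base E) (row_base_free E) (col_base_full E).
move: (col_base E) (row_base E) => A B AB Bfree Afull.
apply: (row_free_inj Bfree); apply: (row_full_inj Afull).
by rewrite /= mul1mx !mulmxA AB -mulmxA AB.
Qed.

(** The Kronecker product of the identity of size [n] with [A], for rectangular [A] so that it
    applies to the factors of a rank factorisation. *)
Definition block_copies n d r (A : 'M[K]_(d, r)) :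
    'M[K]_(\sum_(i < n) d, \sum_(i < n) r) :=
  \mxblock_(i < n, j < n) (A *+ (i == j)).

Lemma block_copies_mul n d r t (A : 'M[K]_(d, r)) (B : 'M[K]_(r, t)) :
  block_copies n A *m block_copies n B = block_copies n (A *m B).
Proof.
rewrite mul_mxblock; apply/eq_mxblockP => i j.
rewrite (bigD1 i) //= eqxx mulr1n big1 ?addr0 => [|l /negPf li].
  by case: eqP => // _; rewrite mulmx0.
by rewrite eq_sym li mul0mx.
Qed.

Lemma block_copiesD n d r (A B : 'M[K]_(d, r)) :
  block_copies n (A + B) = block_copies n A + block_copies n B.
Proof. by rewrite -mxblockD; apply/eq_mxblockP => i j; rewrite mulrnDl. Qed.

Lemma block_copies0 n d r : block_copies n (0 : 'M[K]_(d, r)) = 0.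
Proof. by rewrite -[RHS]mxblock0; apply/eq_mxblockP => i j; rewrite mul0rn. Qed.

Lemma block_copies_sum n d r (I : finType) (A : I -> 'M[K]_(d, r)) :
  block_copies n (\sum_i A i) = \sum_i block_copies n (A i).
Proof. exact: (big_morph _ (@block_copiesD n d r) (block_copies0 n d r)). Qed.

Lemma block_copiesE n d (A : 'M[K]_d) : block_copies n A = \mxdiag_(i < n) A.
Proof.
by apply/eq_mxblockP => i j; case: eqP => _; rewrite ?conform_mx_id.
Qed.

Lemma block_copies1 n d : block_copies n (1%:M : 'M[K]_d) = 1%:M.
Proof. by rewrite block_copiesE -mxdiagZ. Qed.

Lemma block_copies_inj n d r : (0 < n)%N -> injective (@block_copies n d r).
Proof.
case: n => // n _ A B; rewrite /block_copies => /eq_mxblockP/(_ ord0 ord0).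
by rewrite eqxx.
Qed.

End BlockMatrices.

(** * Ranks of idempotents over the matricial closure *)

Section Ranks.
Variables (n : nat) (K : fieldType).
Hypothesis n_gt0 : (0 < n)%N.
Local Notation R := (MC n K).

Definition MC_in k : 'M[K]_(n ^ k) -> R :=
  @dl_in (fun k => 'M[K]_(n ^ k)) (fun k => @MC_map n K k) k.

HB.instance Definition _ k :=
  GRing.isZmodMorphism.Build 'M[K]_(n ^ k) R (@MC_in k)
    (@dl_in_zmod (fun k => 'M[K]_(n ^ k)) (fun k => @MC_map n K k) k).
HB.instance Definition _ k :=
  GRing.isMonoidMorphism.Build 'M[K]_(n ^ k) R (@MC_in k)
    (@dl_in_monoid (fun k => 'M[K]_(n ^ k)) (fun k => @MC_map n K k) k).

Lemma MC_in_inj k : injective (@MC_in k).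
Proof.
apply: dl_in_inj => {}k A B; rewrite /= /MC_map -!block_copiesE.
by case: _ / (sum_expn n k) => /=; exact: block_copies_inj.
Qed.

Lemma MC_in_mul k (A B : 'M[K]_(n ^ k)) : MC_in (A *m B) = MC_in A * MC_in B.
Proof. exact: rmorphM. Qed.

Lemma MC_in_map k (A : 'M[K]_(n ^ k)) : MC_in (MC_map A) = MC_in A.
Proof.
exact: (@dl_inS (fun k => 'M[K]_(n ^ k)) (fun k => @MC_map n K k)).
Qed.

Lemma MC_in_mx m p (X : 'M[R]_(m, p)) : exists k0, forall k, (k0 <= k)%N ->
  exists Y : 'I_m -> 'I_p -> 'M[K]_(n ^ k), X = \matrix_(i, j) MC_in (Y i j).
Proof.
have [k0 Pk] := dl_in_fin (fun ij : 'I_m * 'I_p => X ij.1 ij.2).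
exists k0 => k /Pk[a aE]; exists (fun i j => a (i, j)).
by apply/matrixP => i j; rewrite mxE; exact: aE (i, j).
Qed.

(* [A] and [B], stacked into a column and a row of blocks, form a rank
   factorisation over [K] of the flattened [E].  Keeping them as families makes
   the passage to level [k + 1] blockwise, with no permutation of indices. *)
Definition has_rank m (E : 'M[R]_m) k r : Prop :=
  exists (A : 'I_m -> 'M[K]_(n ^ k, r)) (B : 'I_m -> 'M[K]_(r, n ^ k)),
    E = \matrix_(i, j) MC_in (A i *m B j) /\ \sum_i B i *m A i = 1%:M.

Lemma MC_in_mulmx k m p q (X : 'I_m -> 'I_p -> 'M[K]_(n ^ k))
    (Y : 'I_p -> 'I_q -> 'M[K]_(n ^ k)) :
  \matrix_(i, j) MC_in (X i j) *m \matrix_(i, j) MC_in (Y i j) =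
  \matrix_(i, j) MC_in (\sum_l X i l *m Y l j).
Proof.
apply/matrixP => i j; rewrite !mxE raddf_sum; apply: eq_bigr => l _ /=.
by rewrite !mxE MC_in_mul.
Qed.

(** Injectivity of [MC_in] lets matrix identities over the closure descend to [K], where rank
    arguments apply. *)
Lemma MC_in_eqmx k m p (X Y : 'I_m -> 'I_p -> 'M[K]_(n ^ k)) :
  \matrix_(i, j) MC_in (X i j) = \matrix_(i, j) MC_in (Y i j) ->
  \mxblock_(i, j) X i j = \mxblock_(i, j) Y i j.
Proof.
move/matrixP => XY; apply/eq_mxblockP => i j.
by have := XY i j; rewrite !mxE => /MC_in_inj.
Qed.

(** At a level carrying all entries of [E], the flattened matrix is idempotent over [K]; its rank
    factorisation is cut back into blocks. *)
Lemma has_rank_ex m (E : 'M[R]_m) : E *m E = E -> exists k r, has_rank E k r.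
Proof.
move=> EE; have [k /(_ k (leqnn k))[Y YE]] := MC_in_mx E.
move: EE; rewrite YE MC_in_mulmx => /MC_in_eqmx.
rewrite -mul_mxblock => /idem_factor[r [A [B [AB BA]]]].
exists k, r, (submxcol A), (submxrow B); split.
  apply/matrixP => i j; rewrite !mxE; congr MC_in.
  have := AB; rewrite -[A in A *m _]submxcolK -[B in _ *m B]submxrowK.
  by rewrite mul_mxcol_mxrow => /eq_mxblockP.
by rewrite -mul_mxrow_mxcol submxcolK submxrowK.
Qed.

(** Taking [n] diagonal copies is multiplicative, so it can be applied to both factors, and the
    inner size is multiplied by [n]. *)
Lemma has_rankS m (E : 'M[R]_m) k r : has_rank E k r -> has_rank E k.+1 (n * r).
Proof.
case=> A [B [EE BA]].
(* With the inner size in the form produced by [block_copies], only the outer sizes need a cast. *)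
suff : has_rank E k.+1 (\sum_(i < n) r) by rewrite sum_nat_const card_ord.
exists (fun i => castmx (sum_expn n k, erefl) (block_copies n (A i))).
exists (fun i => castmx (erefl, sum_expn n k) (block_copies n (B i))); split.
  rewrite EE; apply/matrixP => i j; rewrite !mxE -MC_in_map; congr MC_in.
  rewrite /MC_map -block_copiesE -block_copies_mul.
  by case: _ / (sum_expn n k).
have -> : (1%:M : 'M[K]_(\sum_(i < n) r)) =
    \sum_i block_copies n (B i) *m block_copies n (A i).
  rewrite -block_copies1 -BA block_copies_sum.
  by apply: eq_bigr => i _; rewrite block_copies_mul.
by apply: eq_bigr => i _; case: _ / (sum_expn n k).
Qed.

Lemma has_rankD m (E : 'M[R]_m) k r d :
  has_rank E k r -> has_rank E (d + k) (n ^ d * r).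
Proof.
move=> H; elim: d => [|d IH]; first by rewrite mul1n.
by rewrite addSn expnS -mulnA; exact: has_rankS.
Qed.

Lemma has_rank_le m (E : 'M[R]_m) k r l : (k <= l)%N ->
  has_rank E k r -> has_rank E l (n ^ (l - k) * r).
Proof. by move=> kl /(has_rankD (l - k)); rewrite subnK. Qed.

(** At a common level [l], an identity matrix of the size of the first rank factors through the
    second; both ranks carry the same positive factor [n ^ (l - k)]. *)
Lemma has_rank_le_equiv m p (E : 'M[R]_m) (F : 'M[R]_p)
    (X : 'M[R]_(m, p)) (Y : 'M[R]_(p, m)) k r t :
  X *m Y = E -> Y *m X = F -> has_rank E k r -> has_rank F k t -> (r <= t)%N.
Proof.
move=> XY YX HE HF.
have [k1 Xk] := MC_in_mx X; have [k2 Yk] := MC_in_mx Y.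
pose l := maxn k (maxn k1 k2).
have kl : (k <= l)%N by exact: leq_maxl.
have [X' X'E] := Xk l (leq_trans (leq_maxl _ _) (leq_maxr _ _)).
have [Y' Y'E] := Yk l (leq_trans (leq_maxr _ _) (leq_maxr _ _)).
have [A [B [EE BA]]] := has_rank_le kl HE.
have [C [D [FE DC]]] := has_rank_le kl HF.
rewrite -(@leq_pmul2l (n ^ (l - k))) ?expn_gt0 ?n_gt0 //.
move: XY YX; rewrite {}EE {}FE {}X'E {}Y'E !MC_in_mulmx.
move=> /MC_in_eqmx + /MC_in_eqmx.
rewrite -!mul_mxblock -!mul_mxcol_mxrow => XY YX.
move: BA DC; rewrite -!mul_mxrow_mxcol.
move: (\mxcol_i A i) (\mxcol_i C i) (\mxrow_i B i) (\mxrow_i D i) XY YX.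
move=> a c b d.
move: (mxblock _) (mxblock _) => y x XY YX BA DC.
(* Since [c *m d = y *m x] and [x *m y = a *m b], the product of these two matrices is
   [b *m (a *m b) *m (a *m b) *m a], which is the identity. *)
apply: (@mulmx1_min _ _ _ (b *m x *m c) (d *m y *m a)).
rewrite !mulmxA -(mulmxA (b *m x) c) -YX !mulmxA -(mulmxA b) XY.
by rewrite !mulmxA BA mul1mx -(mulmxA b) XY !mulmxA BA mul1mx BA.
Qed.

(** The factors are crossed, [A] with [D] and [C] with [B]; in the products of [X] and [Y] the inner
    sums are identities. *)
Lemma has_rank_equiv m p (E : 'M[R]_m) (F : 'M[R]_p) k r :
  has_rank E k r -> has_rank F k r ->
  exists (X : 'M[R]_(m, p)) (Y : 'M[R]_(p, m)), X *m Y = E /\ Y *m X = F.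
Proof.
case=> A [B [-> BA]] [C [D [-> DC]]].
exists (\matrix_(i, j) MC_in (A i *m D j)), (\matrix_(i, j) MC_in (C i *m B j)).
rewrite !MC_in_mulmx; split; apply/matrixP => i j; rewrite !mxE; congr MC_in.
  rewrite -[A i in RHS]mulmx1 -DC mulmx_sumr mulmx_suml.
  by apply: eq_bigr => l _; rewrite !mulmxA.
rewrite -[C i in RHS]mulmx1 -BA mulmx_sumr mulmx_suml.
by apply: eq_bigr => l _; rewrite !mulmxA.
Qed.

Lemma has_rank_block m p (E : 'M[R]_m) (F : 'M[R]_p) k r t :
  has_rank E k r -> has_rank F k t -> has_rank (block_mx E 0 0 F) k (r + t).
Proof.
case=> A [B [-> BA]] [C [D [-> DC]]].
have sl (i : 'I_m) : split (lshift p i) = inl i := unsplitK (inl i).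
have sr (i : 'I_p) : split (rshift m i) = inr i := unsplitK (inr i).
exists (fun i => match split i with
  inl j => row_mx (A j) 0 | inr j => row_mx 0 (C j) end).
exists (fun i => match split i with
  inl j => col_mx (B j) 0 | inr j => col_mx 0 (D j) end); split.
  apply/matrixP => i j; rewrite [RHS]mxE.
  case: (split_ordP i) => i' ->; case: (split_ordP j) => j' ->;
    rewrite ?sl ?sr mul_row_col ?mulmx0 ?mul0mx ?addr0 ?add0r.
  - by rewrite block_mxEul mxE.
  - by rewrite block_mxEur mxE raddf0.
  - by rewrite block_mxEdl mxE raddf0.
  - by rewrite block_mxEdr mxE.
rewrite big_split_ord /=.
rewrite (eq_bigr (fun i => block_mx (B i *m A i) 0 0 0)); last first.
  by move=> i _; rewrite sl mul_col_row !mulmx0 mul0mx.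
rewrite [X in _ + X](eq_bigr (fun i => block_mx 0 0 0 (D i *m C i))); last first.
  by move=> i _; rewrite sr mul_col_row !mul0mx mulmx0.
have -> : \sum_i block_mx (B i *m A i) 0 0 0 =
    block_mx 1%:M 0 0 0 :> 'M[K]_(r + t).
  rewrite -BA; elim/big_rec2: _ => [|i x y _ ->]; first by rewrite block_mx0.
  by rewrite add_block_mx !addr0.
have -> : \sum_i block_mx 0 0 0 (D i *m C i) =
    block_mx 0 0 0 1%:M :> 'M[K]_(r + t).
  rewrite -DC; elim/big_rec2: _ => [|i x y _ ->]; first by rewrite block_mx0.
  by rewrite add_block_mx !addr0.
by rewrite add_block_mx !addr0 add0r -scalar_mx_block.
Qed.

(** At level [0] the blocks are scalars, and standard basis vectors give the factors. *)
Lemma has_rank1 p : has_rank (1%:M : 'M[R]_p) 0 p.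
Proof.
exists (fun i => delta_mx ord0 i), (fun i => delta_mx i ord0); split.
  apply/matrixP => i j; rewrite !mxE mul_delta_mx_cond.
  case: eqP => _; last by rewrite raddf0.
  rewrite -(rmorph1 (@MC_in 0)); congr MC_in.
  by apply/matrixP => a b; rewrite !mxE !ord1.
by rewrite (mx1_sum_delta _ p); apply: eq_bigr => i _; rewrite mul_delta_mx.
Qed.

(** The witness is diagonal, with the same rank-one matrix unit of ['M[K]_(n ^ k)] in all [r]
    diagonal entries. *)
Lemma has_rank_diag r k : exists E : 'M[R]_r, E *m E = E /\ has_rank E k r.
Proof.
have d_gt0 : (0 < n ^ k)%N by rewrite expn_gt0 n_gt0.
pose o := Ordinal d_gt0.
pose A i : 'M[K]_(n ^ k, r) := delta_mx o i.
pose B i : 'M[K]_(r, n ^ k) := delta_mx i o.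
have BA : \sum_i B i *m A i = 1%:M.
  rewrite (mx1_sum_delta _ r); apply: eq_bigr => i _.
  by rewrite /A /B mul_delta_mx.
exists (\matrix_(i, j) MC_in (A i *m B j)); split; last by exists A, B.
rewrite MC_in_mulmx; apply/matrixP => i j; rewrite !mxE; congr MC_in.
rewrite -[A i in RHS]mulmx1 -BA mulmx_sumr mulmx_suml.
by apply: eq_bigr => l _; rewrite !mulmxA.
Qed.


(** * The rational dimension of a module *)

Definition mod_dim (P : lmodType R) (q : rat) : Prop :=
  exists m (E : 'M[R]_m) k r,
    [/\ presents P E, has_rank E k r & q = r%:R / n%:R ^+ k].

Let nX k : (n%:R ^+ k : rat) != 0.
Proof. by rewrite expf_neq0 // pnatr_eq0 -lt0n. Qed.

Let div_le k l r : (k <= l)%N ->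
  r%:R / n%:R ^+ k = (n ^ (l - k) * r)%:R / n%:R ^+ l :> rat.
Proof.
move=> kl; rewrite natrM natrX -{2}(subnK kl) exprD.
by field; rewrite nX nX.
Qed.

(** Raising both idempotents to the larger level puts the two fractions over a common
    denominator. *)
Lemma mod_dim_le (P Q : lmodType R) p q : mod_dim P p -> mod_dim Q q ->
  exists m m' (E : 'M[R]_m) (F : 'M[R]_m') k r t,
    [/\ presents P E, presents Q F, has_rank E k r, has_rank F k t
      & p = r%:R / n%:R ^+ k /\ q = t%:R / n%:R ^+ k].
Proof.
case=> m [E [k [r [PE HE ->]]]] [m' [F [l [t [QF HF ->]]]]].
have kj := leq_maxl k l; have lj := leq_maxr k l.
exists m, m', E, F, (maxn k l), (n ^ (maxn k l - k) * r)%N,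
  (n ^ (maxn k l - l) * t)%N.
by split; rewrite -?div_le //; exact: has_rank_le.
Qed.

Lemma mod_dim_ex (P : fgproj R) : exists q, mod_dim P q.
Proof.
have [m [E PE]] := presents_fgproj P.
have [k [r HE]] := has_rank_ex (presents_idem PE).
by exists (r%:R / n%:R ^+ k), m, E, k, r.
Qed.

(** At a common level, equal ranks and equivalence of the idempotents imply each other. Applied to a
    single module, this makes its dimension unique. *)
Lemma mod_dim_iso (P Q : lmodType R) p q :
  mod_dim P p -> mod_dim Q q -> p = q <-> mod_iso P Q.
Proof.
move=> Pp Qq.
have [m [m' [E [F [k [r [t [PE QF HE HF [-> ->]]]]]]]]] := mod_dim_le Pp Qq.
split=> [/divIf rt|PQ].
  have {}rt : r = t by apply/eqP; rewrite -(eqr_nat rat); apply/eqP/rt.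
  rewrite -rt in HF; have [X [Y [XY YX]]] := has_rank_equiv HE HF.
  exact: equiv_mod_iso PE QF XY YX.
have [X [Y [XY YX]]] := presents_equiv (presents_iso PQ PE) QF.
congr (_%:R / _); apply/eqP; rewrite eqn_leq.
by rewrite (has_rank_le_equiv XY YX HE HF) (has_rank_le_equiv YX XY HF HE).
Qed.

Lemma mod_dim_prod (P Q : lmodType R) p q :
  mod_dim P p -> mod_dim Q q -> mod_dim (P * Q)%type (p + q).
Proof.
move=> Pp Qq.
have [m [m' [E [F [k [r [t [PE QF HE HF [-> ->]]]]]]]]] := mod_dim_le Pp Qq.
exists (m + m')%N, (block_mx E 0 0 F), k, (r + t)%N; split.
- exact: presents_prod.
- exact: has_rank_block.
- by rewrite natrD mulrDl.
Qed.

Lemma mod_dim_free p : mod_dim 'rV[R]_p p%:R.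
Proof.
exists p, 1%:M, 0%N, p; split; last by rewrite expr0 divr1.
- exact: presents_free.
- exact: has_rank1.
Qed.

Lemma mod_dim_surj k r : exists P : fgproj R, mod_dim P (r%:R / n%:R ^+ k).
Proof.
have [E [EE HE]] := has_rank_diag r k; have [P PE] := presents_ex EE.
exists (FGProj (presents_fin_gen PE) (presents_projective PE)).
by exists r, E, k, r.
Qed.

Lemma MC_IBN : has_IBN R.
Proof.
move=> p q /(mod_dim_iso (mod_dim_free p) (mod_dim_free q)) /eqP.
by rewrite eqr_nat => /eqP.
Qed.

(** * Fractions whose denominator is a power of [n] *)

Lemma Zinv_nat r k : (r%:R / n%:R ^+ k : rat) \in Zinv_pred n.
Proof.
apply/asboolP => S [S1 SB SM] nS.
have S0 : 0 \in S by rewrite -(subrr 1) SB.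
have SD x y : x \in S -> y \in S -> x + y \in S.
  by move=> xS yS; rewrite -[y]opprK -[- y]add0r SB // SB.
rewrite -exprVn; apply: (SM).
  by elim: r => // r IH; rewrite mulrS SD.
by elim: k => // k IH; rewrite exprS SM.
Qed.

Lemma ZinvP (x : Zinv n) :
  exists k r t, val x = r%:R / n%:R ^+ k - t%:R / n%:R ^+ k.
Proof.
(* These fractions form a subring containing [n%:R^-1], hence contain every element of [Zinv n]. *)
pose S : {pred rat} := fun x => `[< exists k (z : int), x = z%:~R / n%:R ^+ k >].
have SC : subring_closed S.
  split.
  - by apply/asboolP; exists 0%N, 1; rewrite expr0 divr1.
  - move=> _ _ /asboolP[k [y ->]] /asboolP[l [z ->]]; apply/asboolP.
    exists (k + l)%N, (y * n%:R ^+ l - z * n%:R ^+ k).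
    rewrite rmorphB !rmorphM !rmorphXn /= !rmorph_nat exprD.
    by field; rewrite !nX.
  - move=> _ _ /asboolP[k [y ->]] /asboolP[l [z ->]]; apply/asboolP.
    by exists (k + l)%N, (y * z); rewrite rmorphM exprD; field; rewrite !nX.
have nS : n%:R^-1 \in S by apply/asboolP; exists 1%N, 1; rewrite expr1 div1r.
have /asboolP/(_ S SC nS)/asboolP[k [z ->]] := valP x; exists k.
(* A nonnegative numerator goes to the first term, the opposite of a negative one to the second;
   [Negz r] stands for the opposite of [r.+1]. *)
case: z => r; first by exists r, 0%N; rewrite mul0r subr0.
by exists 0%N, r.+1; rewrite mul0r sub0r NegzE rmorphN mulNr.
Qed.

End Ranks.

(** * Recognising a Grothendieck group *)

Lemma groth_iso (M : Type) (op : M -> M -> M) (e0 : M) (V : zmodType)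
    (d : M -> V) :
  associative op -> commutative op ->
  {morph d : a b / op a b >-> a + b} -> injective d ->
  (forall v, exists a b, v = d a - d b) ->
  exists f : groth op -> V, bijective f /\
    forall x y, f (groth_add x y) = f x + f y.
Proof.
move=> opA opC dD dI dS; pose f (x : groth op) := d (rep x).1 - d (rep x).2.
(* Additivity of [d] removes the stabilising summand [e] in the group [V]; injectivity brings the
   equality back to [M], where [e0] serves as the summand. *)
have eqE x y : groth_rel op x y <-> d x.1 - d x.2 = d y.1 - d y.2.
  split=> [[e /(congr1 d)]|E].
    rewrite !dD => /addIr E.
    by apply/eqP; rewrite subr_eq addrAC -E addrK.
  exists e0; congr (op _ e0); apply: dI; rewrite !dD.
  by move/eqP: E; rewrite subr_eq addrAC => /eqP ->; rewrite subrK.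
have fE x : f (cls (groth_rel op) x) = d x.1 - d x.2.
  apply/eqE.
  exact: (rep_cls (groth_refl op e0) (@groth_sym _ op) (groth_trans opA opC)).
exists f; split=> [|x y].
  pose g v :=
    cls (groth_rel op) (sval (cid (dS v)), sval (cid (svalP (cid (dS v))))).
  exists g => [x|v].
    rewrite /g -[RHS]repK; apply/(groth_cls_eq e0 opA opC)/eqE => /=.
    by case: cid => a /= ab; case: cid => b /= <-.
  by rewrite /g fE /=; case: cid => a /= ab; case: cid => b /= <-.
by rewrite -(repK x) -(repK y) (groth_addE e0) // !fE /= !dD opprD addrACA.
Qed.

Theorem mainTheorem20 (n : nat) (n_gt0 : (0 < n)%N) (K : fieldType) :
  (exists f : K0 (MC n K) -> Zinv n,
      bijective f /\ forall x y, f (K0_add x y) = f x + f y) /\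
  has_IBN (MC n K).
Proof.
split; last exact: MC_IBN.
pose dim (a : isoclass (MC n K)) := sval (cid (mod_dim_ex n_gt0 (rep a))).
have dimP (a : isoclass (MC n K)) : mod_dim (rep a) (dim a) by exact: svalP (cid _).
have dimZ (a : isoclass (MC n K)) : dim a \in Zinv_pred n.
  by have [m [E [k [r [_ _ ->]]]]] := dimP a; exact: Zinv_nat.
pose d a := MkZinv (dimZ a).
(* Although [d] is computed on a chosen representative, any dimension of [P] is its value at the
   class of [P], as the representative is isomorphic to [P]. *)
have dE (P : fgproj (MC n K)) q :
    mod_dim P q -> val (d (cls (@fgproj_iso _) P)) = q.
  move=> Pq; apply/(mod_dim_iso n_gt0 (dimP _) Pq)/isoclass_eq.
  by rewrite repK.
apply: (@groth_iso _ _ (isoclass0 (MC n K)) _ d).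
- exact: isoclass_addA.
- exact: isoclass_addC.
- move=> a b; apply: val_inj; rewrite /isoclass_add.
  exact: (dE (fgproj_sum _ _) _ (mod_dim_prod n_gt0 (dimP a) (dimP b))).
- move=> a b /(congr1 val) /= /(mod_dim_iso n_gt0 (dimP a) (dimP b)) /isoclass_eq.
  by rewrite !repK.
- move=> v; have [k [r [t vE]]] := ZinvP n_gt0 v.
  have [P Pr] := mod_dim_surj K n_gt0 k r.
  have [Q Qt] := mod_dim_surj K n_gt0 k t.
  exists (cls (@fgproj_iso _) P), (cls (@fgproj_iso _) Q); apply: val_inj.
  by rewrite vE -(dE _ _ Pr) -(dE _ _ Qt).
Qed.
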